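(* Let $\mathcal{G}$ be a multiple-unicasts network with $k$ sources and $m$ links, let $G$ be the digraph on $m$ vertices obtained from $\mathcal{G}$, and let $\widetilde{\mathcal{G}}$ be the modified network (both as defined in the context). Then any feedback vertex set of $G$ corresponds (identifying the vertices of $G$ with the links of $\mathcal{G}$, each of which is also a link of $\widetilde{\mathcal{G}}$) to a GNS cut in $\widetilde{\mathcal{G}}$ with the same capacity. In turn, $$m-\mathrm{MAIS}(G)\;=\;\mathrm{GNSCUT}(\widetilde{\mathcal{G}}).$$
   Context: **Multiple-unicasts (MU) network.** A finite acyclic directed network $\mathcal{G}(\mathcal{V},\mathcal{E})$ (parallel links allowed), where every link $e\in\mathcal{E}$ has unit capacity and is directed from its tail $t(e)$ to its head $h(e)$. There are $k$ source nodes $s_1,\dots,s_k$ and $k$ destination nodes $t_1,\dots,t_k$. For each $i$ there is a set $\mathcal{E}_i\subset\mathcal{E}$ of exactly $\mathrm{mincut}(s_i,t_i)$ *source links* of $s_i$, which have head $s_i$ and no tail; $\mathrm{mincut}(s_i,t_i)$ is the minimum number of unit-capacity links separating $t_i$ from $s_i$. All links not in $\bigcup_i\mathcal{E}_i$ have a tail and a head. $m=|\mathcal{E}|$ counts all links, including source links. **The digraph $G$.** Let $\mathcal{G}'$ be the network obtained from $\mathcal{G}$ by setting $t(e)=t_i$ for all $e\in\mathcal{E}_i$, $i=1,\dots,k$. $G$ is the reversed line graph of $\mathcal{G}'$: its vertices are the $m$ links of $\mathcal{G}'$, and there is a directed edge from $e$ to $\hat e$ iff $h(\hat e)=t(e)$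 in $\mathcal{G}'$. **The network $\widetilde{\mathcal{G}}$.** It is obtained from $\mathcal{G}$ by (1) adding $k$ new nodes $\widetilde s_1,\dots,\widetilde s_k$; (2) setting $t(e)=\widetilde s_i$ for all $e\in\mathcal{E}_i$, $i=1,\dots,k$; (3) adding, for each $i$, a set $\widetilde{\mathcal{E}}_i$ of $|\mathcal{E}_i|$ new links with head $\widetilde s_i$ and no tail. It is an MU network with sources $\widetilde s_1,\dots,\widetilde s_k$, source links $\widetilde{\mathcal{E}}_i$, and respective destinations $t_1,\dots,t_k$. **MAIS and feedback vertex sets.** $\mathrm{MAIS}(G)$ is the cardinality of the largest $\widehat V\subseteq V(G)$ such that the subgraph of $G$ induced by $\widehat V$ has no directed cycle. A feedback vertex set of $G$ is a set $\mathcal{F}\subseteq V(G)$ such that the subgraph induced by $V(G)\setminus\mathcal{F}$ is acyclic. **GNS cut.** A GNS (Generalized Network Sharing) cut of an MU network with link set $\mathcal{E}$, sources $\sigma_1,\dots,\sigma_k$ and destinations $t_1,\dots,t_k$ is a subset $S\subset\mathcal{E}$ such that, after removing the links in $S$, there is a permutation $\pi:[k]\to[k]$ such that for all $i,j\in[k]$, if $\pi(i)\ge\pi(j)$ then there is no path from $\sigma_i$ to $t_j$. $\mathrm{GNSCUT}$ of the network is the smallest capacity (number of unit-capacity links) of a GNS cut. *)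

(* Defs.v *)
From mathcomp Require Import all_boot.
From mathcomp Require Import perm.

Set Implicit Arguments.
Unset Strict Implicit.
Unset Printing Implicit Defensive.

Section Digraphs.
Variable T : finType.
Implicit Types (r : rel T) (A F : {set T}).

Definition induced r A : rel T := [rel x y | [&& x \in A, y \in A & r x y]].

(* Boolean form of "no directed cycle" (loops count as cycles); see
   [acyclicP]. *)
Definition acyclic r : bool := [forall x, forall y, r x y ==> ~~ connect r y x].

Lemma acyclicP r :
  reflect (forall c : seq T, c != [::] -> ~~ cycle r c) (acyclic r).
Proof.
apply: (iffP forallP) => [acy [//|x p] _ | acy x].
  apply/negP; rewrite /= rcons_path; case: p => [|y p] /=.
    by move=> rxx; have /forallP/(_ x) := acy x; rewrite rxx connect0.
  case/andP => /andP[rxy pyp] rlx.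
  have /forallP/(_ y) := acy x; rewrite rxy /= => /negP; apply.
  apply: connect_trans (connect1 rlx).
  by apply/connectP; exists p.
apply/forallP => y; apply/implyP => rxy; apply/negP => /connectP[p pyp xl].
have /negP := acy (y :: p) isT; apply.
by rewrite /= rcons_path pyp -xl.
Qed.

Definition MAIS r : nat := \max_(A : {set T} | acyclic (induced r A)) #|A|.

Definition feedback_vertex_set r F : bool := acyclic (induced r (~: F)).

End Digraphs.

(* Every link has unit capacity, so the capacity of a set of links is its
   cardinal. Parallel links are allowed. *)
Record network := Network {
  node : finType;
  link : finType;
  tail : link -> option node;
  head : link -> node
}.

Definition node_rel (N : network) (S : {set link N}) : rel (node N) :=
  [rel u v | [exists e, [&& e \notin S, tail e == Some u & head e == v]]].

Definition has_path (N : network) (S : {set link N}) (u v : node N) : bool :=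
  connect (node_rel S) u v.

(* The set of all links is the default of the arg min; it is itself separating
   as soon as [u != v]. *)
Definition mincut (N : network) (u v : node N) : nat :=
  #|[arg min_(S < [set: link N] | ~~ has_path S u v) #|S| ]|.

(* [slinks i] is the set of source links of session [i]. The nodes [src i]
   (resp. [dst i]) may coincide for different [i]; only the sets of source links
   are disjoint. *)
Record mu_network (k : nat) := MUNetwork {
  mu_net :> network;
  src : 'I_k -> node mu_net;
  dst : 'I_k -> node mu_net;
  slinks : 'I_k -> {set link mu_net};
  mu_acyclic : acyclic (@node_rel mu_net set0);
  src_neq_dst : forall i, src i != dst i;
  head_slinks : forall i e, e \in slinks i -> head e = src i;
  tail_slinks : forall i e, e \in slinks i -> tail e = None;
  disjoint_slinks : forall i j, i != j -> [disjoint slinks i & slinks j];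
  card_slinks : forall i, #|slinks i| = mincut (src i) (dst i);
  tail_nonslinks :
    forall e, e \notin \bigcup_i slinks i -> exists u, tail e = Some u
}.

Section Constructions.
Variables (k : nat) (N : mu_network k).

Definition session_of (e : link N) : option 'I_k := [pick i | e \in slinks N i].

(* The source links of session [i] are redirected to start at [dst i]. *)
Definition closed_network : network :=
  @Network (node N) (link N)
    (fun e => if session_of e is Some i then Some (dst N i) else tail e)
    (@head N).

(* The reversed line graph of [closed_network]. *)
Definition link_digraph : rel (link N) :=
  [rel e f | @tail closed_network e == Some (@head closed_network f)].

(* [inr i] is the new source of session [i], and [inr (Tagged _ j)] its [j]-th
   new source link; the old source links of [i] now start at [inr i]. *)
Definition ext_node : finType := (node N + 'I_k)%type.

Definition ext_link : finType := (link N + {i : 'I_k & 'I_#|slinks N i|})%type.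

Definition ext_tail (e : ext_link) : option ext_node :=
  match e with
  | inl e => if session_of e is Some i then Some (inr i)
             else omap inl (tail e)
  | inr _ => None
  end.

Definition ext_head (e : ext_link) : ext_node :=
  match e with
  | inl e => inl (head e)
  | inr x => inr (tag x)
  end.

Definition ext_net : network := Network ext_tail ext_head.

Definition ext_src (i : 'I_k) : node ext_net := inr i.

Definition ext_dst (i : 'I_k) : node ext_net := inl (dst N i).

Definition ext_slinks (i : 'I_k) : {set link ext_net} :=
  [set e : ext_link | if e is inr x then tag x == i else false].

Definition ext_set (F : {set link N}) : {set link ext_net} :=
  [set (inl e : ext_link) | e in F].

Lemma session_of_slinks e i : e \in slinks N i -> session_of e = Some i.
Proof.
rewrite /session_of => ei; case: pickP => [j ej|/(_ i)]; last by rewrite ei.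
case: (eqVneq j i) => [->//|/(@disjoint_slinks k N)].
by move/disjointFr => /(_ _ ej); rewrite ei.
Qed.

Lemma session_of_in e i : session_of e = Some i -> e \in slinks N i.
Proof. by rewrite /session_of; case: pickP => // j ej [<-]. Qed.

Lemma session_of_tail e u : tail e = Some u -> session_of e = None.
Proof.
move=> eu; case E: (session_of e) => [i|//].
by move/session_of_in/tail_slinks: E; rewrite eu.
Qed.

Lemma ext_node_rel (S : {set link ext_net}) (x y : node ext_net) :
  node_rel S x y ->
  exists2 v, y = inl v &
    forall u, x = inl u -> node_rel [set e | inl e \in S] u v.
Proof.
case/existsP => -[e|e] /and3P[eS /eqP te /eqP he] //.
exists (head e) => // u xu; subst x; apply/existsP; exists e.
rewrite inE eS eqxx andbT /=.
move: te; rewrite /= ; case: session_of => //.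
by case: tail => //= w [->].
Qed.

Lemma ext_connect (S : {set link ext_net}) (u : node N) (y : node ext_net) :
  has_path S (inl u) y ->
  exists2 v, y = inl v & has_path [set e | inl e \in S] u v.
Proof.
case/connectP => p; elim: p u => [|z p IHp] u /=.
  by move=> _ ->; exists u => //; exact: connect0.
case/andP => /ext_node_rel[v -> /(_ u erefl) uv] /IHp h /h [w -> vw].
by exists w => //; apply: connect_trans vw; apply: connect1.
Qed.

Lemma connect_ext (S : {set link ext_net}) (u v : node N) :
  has_path [set e | inl e \in S] u v -> has_path S (inl u) (inl v).
Proof.
case/connectP => p; elim: p u => [|z p IHp] u /=.
  by move=> _ ->; exact: connect0.
case/andP => /existsP[e /and3P[eS /eqP te /eqP he]] /IHp h /h.
apply: connect_trans; apply: connect1; apply/existsP; exists (inl e).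
rewrite inE in eS; rewrite eS /= (session_of_tail te) te he /=.
by rewrite !eqxx.
Qed.

Lemma ext_acyclic : acyclic (@node_rel ext_net set0).
Proof.
have E : [set e : link N | (inl e : link ext_net) \in set0] = set0.
  by apply/setP => e; rewrite !inE.
apply/forallP => x; apply/forallP => y; apply/implyP.
case/ext_node_rel => v -> xv; apply/negP => /ext_connect[u xu vu].
move: (xv _ xu) vu; rewrite E => uv vu.
by move: (mu_acyclic N) => /forallP/(_ u)/forallP/(_ v); rewrite uv => /negP.
Qed.

Lemma ext_src_neq_dst i : ext_src i != ext_dst i.
Proof. by []. Qed.

Lemma ext_head_slinks i (e : link ext_net) :
  e \in ext_slinks i -> head e = ext_src i.
Proof. by rewrite inE; case: e => //= x /eqP->. Qed.

Lemma ext_tail_slinks i (e : link ext_net) : e \in ext_slinks i -> tail e = None.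
Proof. by rewrite inE; case: e. Qed.

Lemma ext_disjoint_slinks i j :
  i != j -> [disjoint ext_slinks i & ext_slinks j].
Proof.
move=> ij; apply/pred0P => -[e|x] //=; rewrite !inE //.
by apply/negP => /andP[/eqP-> /eqP E]; rewrite E eqxx in ij.
Qed.

Lemma card_ext_slinks0 i : #|ext_slinks i| = #|slinks N i|.
Proof.
pose f (j : 'I_#|slinks N i|) : ext_link :=
  inr (Tagged (fun i => 'I_#|slinks N i|) j).
have f_inj : injective f.
  move=> j j' E; apply: (@eq_from_Tagged _ (fun i => 'I_#|slinks N i|) i).
  by case: E.
rewrite -[RHS]card_ord -(card_imset _ f_inj).
apply: eq_card => -[e|[i' j]]; rewrite inE.
  by apply/esym/imsetP => -[].
apply/eqP/imsetP => /= [E|[j' _]].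
  by subst i'; exists j.
by move/(congr1 (fun z : ext_link => if z is inr x then tag x else i)).
Qed.

Lemma card_ext_slinks i :
  #|ext_slinks i| = mincut (ext_src i) (ext_dst i).
Proof.
rewrite card_ext_slinks0 /mincut.
have sepT : ~~ has_path [set: link ext_net] (ext_src i) (ext_dst i).
  apply/negP => /connectP[[|y p] //= /andP[/existsP[e]]].
  by rewrite inE.
case: arg_minnP => // S sepS minS; apply/eqP; rewrite eqn_leq; apply/andP; split.
  have [sub|] := boolP (ext_set (slinks N i) \subset S).
    move/subset_leq_card: sub; rewrite card_imset //; exact: inl_inj.
  case/subsetPn => _ /imsetP[e ei ->] eS.
  have sep : ~~ has_path [set e | (inl e : link ext_net) \in S] (src N i) (dst N i).
    apply: contra sepS => /connect_ext; apply: connect_trans; apply: connect1.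
    apply/existsP; exists (inl e); rewrite eS /= (session_of_slinks ei) eqxx.
    by rewrite (head_slinks ei) eqxx.
  rewrite (card_slinks N) /mincut; case: arg_minnP => [|A _ minA].
    apply/negP => /connectP[[|y p] /=]; first by move/eqP: (src_neq_dst N i) => ns _ /esym.
    by case/andP => /existsP[f]; rewrite inE.
  apply: leq_trans (minA _ sep) _.
  rewrite -(card_imset _ (@inl_inj _ {i : 'I_k & 'I_#|slinks N i|})).
  by apply/subset_leq_card/subsetP => _ /imsetP[f + ->]; rewrite inE.
rewrite -[X in _ <= X](card_imset _ (@inl_inj _ {i : 'I_k & 'I_#|slinks N i|})).
apply: (minS (ext_set (slinks N i))).
apply/negP => /connectP[[|y p] //= /andP[/existsP[[e|b]]]]; last by case/and3P.
case/and3P => eS /eqP /= te _ _ _; move: eS te.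
rewrite mem_imset; last exact: inl_inj.
case E: (session_of e) => [j|]; last by case: tail.
by move=> + [ji]; rewrite -ji (session_of_in E).
Qed.

Lemma ext_tail_nonslinks (e : link ext_net) :
  e \notin \bigcup_i ext_slinks i -> exists u, tail e = Some u.
Proof.
case: e => [e _|x /negP[]] /=; last first.
  by apply/bigcupP; exists (tag x) => //; rewrite inE.
case E: (session_of e) => [j|]; first by eexists.
have [|u ->] := @tail_nonslinks k N e; last by eexists.
by apply/negP => /bigcupP[i _ /session_of_slinks]; rewrite E.
Qed.

Definition ext_network : mu_network k :=
  MUNetwork ext_acyclic ext_src_neq_dst ext_head_slinks ext_tail_slinks
    ext_disjoint_slinks card_ext_slinks ext_tail_nonslinks.

End Constructions.

Arguments link_digraph {k} N _ _.

Definition GNS_cut (k : nat) (N : mu_network k) (S : {set link N}) : bool :=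
  [exists pi : {perm 'I_k}, [forall i, forall j,
     (pi j <= pi i) ==> ~~ has_path S (src N i) (dst N j)]].

Arguments GNS_cut {k} N S.

(* The set of all links is the default of the arg min; it is itself a GNS cut
   as soon as no source coincides with a destination, as in [ext_network]. *)
Definition GNSCUT (k : nat) (N : mu_network k) : nat :=
  #|[arg min_(S < [set: link N] | GNS_cut N S) #|S| ]|.

(* Main.v *)
(** Both directions are proved with potential functions.  If [F] is a feedback
    vertex set, the remaining links carry a rank that increases along paths of
    the closed network; since every surviving source link of session [j] is
    preceded there by all surviving links entering [t_j], ordering the sessions
    by the largest rank of a link entering [t_j] yields the permutation of a GNS
    cut.  Conversely, given a GNS cut with permutation [pi], label each node with
    the largest [pi i] such that the new source of session [i] still reaches it.
    Along the closed network the label never decreases, and it strictly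
    increases across source links, so a cycle would avoid the source links and
    lie in the original acyclic network. *)
From mathcomp Require Import all_boot.
From mathcomp Require Import perm.
Require Import Defs.

Set Implicit Arguments.
Unset Strict Implicit.
Unset Printing Implicit Defensive.

Lemma connect_ind (T : finType) (r : rel T) (P : T -> Prop) (x y : T) :
  P x -> (forall u v, P u -> r u v -> P v) -> connect r x y -> P y.
Proof.
move=> + step /connectP[p]; elim: p x => [|z p IHp] x Px /=; first by move=> _ ->.
by case/andP => xz; apply: IHp; apply: step xz.
Qed.

(** The rank counts the vertices reachable from [x]; acyclicity keeps [x] out of what [y] reaches,
    so the count drops along each edge. *)
Lemma acyclic_rank (T : finType) (r : rel T) :
  acyclic r -> exists g : T -> nat, forall x y, r x y -> g y < g x.
Proof.
move=> acy; exists (fun x => #|connect r x|) => x y rxy.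
apply: proper_card; apply/properP; split.
  by apply/subsetP => z; apply: connect_trans (connect1 rxy).
exists x; first exact: connect0.
by move/forallP/(_ x)/forallP/(_ y)/implyP: acy; apply.
Qed.

(** Take positions in a list sorted by [h]; only strict inequalities matter, so ties are broken
    arbitrarily. *)
Lemma perm_of_rank (k : nat) (h : 'I_k -> nat) :
  exists pi : {perm 'I_k}, forall i j, h i < h j -> pi i < pi j.
Proof.
pose leh := [rel i j | h i <= h j]; pose s := sort leh (enum 'I_k).
have leh_tr : transitive leh by move=> j i l /= /leq_trans; apply.
have s_sorted : sorted leh s by apply: sort_sorted => i j; apply: leq_total.
have s_all i : i \in s by rewrite mem_sort mem_enum.
have s_size : size s = k by rewrite size_sort size_enum_ord.
have idx_lt i : index i s < k by rewrite -[X in _ < X]s_size index_mem.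
have idx_inj : injective (fun i => Ordinal (idx_lt i)).
  by move=> i j [/index_inj]; apply.
exists (perm idx_inj) => i j hij; rewrite !permE /= ltnNge.
apply: contraL hij => ji; rewrite -leqNgt.
by apply: (sorted_leq_index leh_tr _ s_sorted) => // l /=.
Qed.

(** Serves to show that the default of the arg min in [GNSCUT] is a GNS cut. *)
Lemma GNS_cutS (k : nat) (N : mu_network k) (S S' : {set link N}) :
  S \subset S' -> GNS_cut N S -> GNS_cut N S'.
Proof.
move=> sub /existsP[pi cutS]; apply/existsP; exists pi.
apply/forallP => i; apply/forallP => j; apply/implyP => ij.
move/forallP/(_ i)/forallP/(_ j)/implyP/(_ ij): cutS; apply: contra.
apply: connect_sub => u v /existsP[e /and3P[eS te he]].
apply: connect1; apply/existsP; exists e; rewrite te he.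
by rewrite (contra _ eS) //; apply: (subsetP sub).
Qed.

Section Correspondence.
Variables (k : nat) (N : mu_network k).
Implicit Types (F : {set link N}) (S : {set link (ext_network N)}).

Lemma link_digraphE (e f : link N) :
  link_digraph N e f =
  ((if session_of e is Some i then Some (dst N i) else tail e) == Some (head f)).
Proof. by []. Qed.

Lemma card_ext_set F : #|ext_set F| = #|F|.
Proof. by rewrite card_imset //; apply: inl_inj. Qed.

Lemma feedback_vertex_set_GNS_cut F :
  feedback_vertex_set (link_digraph N) F -> GNS_cut (ext_network N) (ext_set F).
Proof.
case/acyclic_rank => g g_lt.
have {}g_lt e f : e \notin F -> f \notin F -> link_digraph N e f -> g f < g e.
  by move=> eF fF ef; apply: g_lt; rewrite /induced /= !inE eF fF.
(* The successor turns [h i <= g f] into [h i < h j] when [f] enters [dst N j]; 0 is left for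
   destinations that no surviving link enters. *)
pose h j := \max_(f | (f \notin F) && (head f == dst N j)) (g f).+1.
have [pi pi_lt] := perm_of_rank h.
apply/existsP; exists pi; apply/forallP => i; apply/forallP => j.
apply/implyP; rewrite leqNgt; apply: contra => ij; apply: pi_lt.
(* Invariant of the nodes reached from the new source of session [i]. *)
pose P (x : node (ext_network N)) := match x with
  | inr l => l = i
  | inl v => exists f, [/\ f \notin F, head f = v & h i <= g f]
  end.
have : P (ext_dst N j).
  apply: connect_ind ij => // x y Px /existsP[[e|b] /and3P[]] // + te /eqP <- /=.
  rewrite mem_imset; last exact: inl_inj.
  move=> eF; exists e; split=> //; move: te => /=.
  case E: (session_of e) => [l|].
    case: x Px => //= _ -> /eqP[li]; subst l.
    apply/bigmax_leqP => f /andP[fF /eqP fi]; apply: g_lt => //.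
    by rewrite link_digraphE E fi.
  case te: (tail e) => [u|] //; case: x Px => //= v [f [fF fv hf]] /eqP[uv].
  apply/ltnW/(leq_ltn_trans hf)/g_lt => //.
  by rewrite link_digraphE E te fv uv.
case=> f [fF fj hf]; apply: leq_ltn_trans hf _.
by apply: (@leq_bigmax_cond _ _ (fun f : link N => (g f).+1)); rewrite fF fj eqxx.
Qed.

Lemma GNS_cut_feedback_vertex_set S :
  GNS_cut (ext_network N) S ->
  feedback_vertex_set (link_digraph N) [set e | inl e \in S].
Proof.
case/existsP => pi cutS; set F := [set e | _].
have {}cutS i j : has_path S (ext_src N i) (ext_dst N j) -> pi i < pi j.
  move=> ij; rewrite ltnNge; apply: contraL ij.
  by move/forallP/(_ i)/forallP/(_ j)/implyP: cutS.
(* [phi v] is one more than the label of [v], and 0 if no source reaches [v]. *)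
pose phi v := \max_(i | has_path S (ext_src N i) (inl v)) (pi i).+1.
(* When [phi] may stay constant, [r] records a link or path of the original network. *)
pose Q (r : rel (node N)) u v := phi u < phi v \/ phi u <= phi v /\ r u v.
have step e f : induced (link_digraph N) (~: F) e f ->
    Q (node_rel set0) (head f) (head e).
  rewrite /induced /= !inE link_digraphE => /and3P[eS fS].
  case E: (session_of e) => [j|] /eqP te.
    (* By the cut, [phi] is at most [pi j] at [dst N j], while the surviving source link [e] lets
       session [j] reach [head e]. *)
    case: te => fj; left; apply: (@leq_trans (pi j).+1).
      by rewrite ltnS -fj; apply/bigmax_leqP => i; apply: cutS.
    apply: (@leq_bigmax_cond _ _ (fun i => (pi i).+1)); apply: connect1.
    by apply/existsP; exists (inl e); rewrite eS /= E !eqxx.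
  right; split.
    apply/bigmax_leqP => i i_f.
    apply: (@leq_bigmax_cond _ _ (fun i => (pi i).+1)).
    apply: connect_trans i_f _; apply: connect1.
    by apply/existsP; exists (inl e); rewrite eS /= E te !eqxx.
  by apply/existsP; exists e; rewrite inE te !eqxx.
have walk e f : connect (induced (link_digraph N) (~: F)) e f ->
    Q (connect (node_rel set0)) (head f) (head e).
  apply: (connect_ind (P := fun f => Q _ (head f) (head e))).
    by right; rewrite connect0.
  move=> u v eu /step uv; case: uv eu => [vu [ue|[ue _]]|[vu ruv [ue|[ue cue]]]].
  - by left; apply: ltn_trans ue.
  - by left; apply: leq_trans ue.
  - by left; apply: leq_ltn_trans ue.
  - right; split; first exact: leq_trans ue.
    exact: connect_trans (connect1 ruv) cue.
apply/forallP => e; apply/forallP => f; apply/implyP => /step ef.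
apply/negP => /walk fe.
(* Around a cycle [phi] cannot increase strictly, which leaves a cycle of the original network. *)
case: ef fe => [lt_fe|[le_fe rfe]] [lt_ef|[le_ef cef]].
- by move: (ltn_trans lt_fe lt_ef); rewrite ltnn.
- by move: (leq_trans lt_fe le_ef); rewrite ltnn.
- by move: (leq_trans lt_ef le_fe); rewrite ltnn.
- move: (mu_acyclic N) => /forallP/(_ (head f))/forallP/(_ (head e)).
  by rewrite rfe cef.
Qed.

Lemma card_sub_MAIS : #|link N| - MAIS (link_digraph N) = GNSCUT (ext_network N).
Proof.
have acy0 : acyclic (induced (link_digraph N) set0).
  by apply/forallP => e; apply/forallP => f; rewrite /induced /= inE.
rewrite /GNSCUT; case: arg_minnP => [|S cutS minS].
  apply: (GNS_cutS (subsetT _)) (feedback_vertex_set_GNS_cut (F := setT) _).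
  by rewrite /feedback_vertex_set setCT.
apply/eqP; rewrite eqn_leq; apply/andP; split.
  have fvs := GNS_cut_feedback_vertex_set cutS.
  (* [S] may contain new source links; dropping them gives [F], which is no larger. *)
  set F := [set e | _] in fvs; apply: (@leq_trans #|F|).
    rewrite leq_subLR -(cardsC F) addnC leq_add2r.
    exact: (@leq_bigmax_cond _ _ (fun A : {set link N} => #|A|)).
  rewrite -card_ext_set; apply/subset_leq_card/subsetP => _ /imsetP[e + ->].
  by rewrite inE.
have [A acyA ->] : {A | acyclic (induced (link_digraph N) A) &
    MAIS (link_digraph N) = #|A|}.
  by apply: eq_bigmax_cond; apply/card_gt0P; exists set0.
have -> : #|link N| - #|A| = #|~: A| by rewrite [RHS]cardsCs setCK.
rewrite -card_ext_set; apply/minS/feedback_vertex_set_GNS_cut.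
by rewrite /feedback_vertex_set setCK.
Qed.

End Correspondence.

Theorem theorem4 (k : nat) (N : mu_network k) :
  (forall F : {set link N},
     feedback_vertex_set (link_digraph N) F ->
     GNS_cut (ext_network N) (ext_set F) /\ #|ext_set F| = #|F|) /\
  #|link N| - MAIS (link_digraph N) = GNSCUT (ext_network N).
Proof.
split; last exact: card_sub_MAIS.
by move=> F /feedback_vertex_set_GNS_cut cutF; rewrite card_ext_set.
Qed.
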